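(* Let $n\ge 1$ be an integer, let $\bar\beta_n=2/n$, and let $$\mathcal{U}^{\bar\beta_n,0}_n=\left\{\cos\left(\frac{j\pi}{n}\right)\right\}_{j=0,\dots,n-1}$$ be the set of $(\beta,\gamma)$-Chebyshev points with $\beta=\bar\beta_n$ and $\gamma=0$ (equivalently, the $n+1$ Chebyshev-Lobatto points $\cos(j\pi/n)$, $j=0,\dots,n$, with the point $-1$ removed). Then the Lebesgue constant of $\mathcal{U}^{\bar\beta_n,0}_n$ for polynomial interpolation on $\Omega=[-1,1]$ is $$\Lambda(\mathcal{U}^{\bar\beta_n,0}_n,\Omega)=2n-1.$$
   Context: For $\beta,\gamma\in[0,2)$ with $\beta+\gamma<2$, and an integer $n\geq 2$, the $(\beta,\gamma)$-Chebyshev points are $\mathcal{U}^{\beta,\gamma}_{n}=\left\{\cos\left(\frac{(2-\beta-\gamma)j\pi}{2(n-1)}+\frac{\gamma\pi}{2}\right)\right\}_{j=0,\dots,n-1}$; for $\beta=2/n$, $\gamma=0$ this is $\{\cos(j\pi/n)\}_{j=0,\dots,n-1}$. For a finite set $\mathcal{X}=\{x_0,\dots,x_{m}\}$ of $m+1$ distinct points of $\Omega=[-1,1]$, the Lagrange polynomials are $\ell_i(x)=\prod_{j=0,\,j\neq i}^{m}\frac{x-x_j}{x_i-x_j}$, $i=0,\dots,m$ (an empty product equals $1$), the Lebesgue function is $\lambda(\mathcal{X};x)=\sum_{i=0}^m|\ell_i(x)|$, and the Lebesgue constant is $\Lambda(\mathcal{X},\Omega)=\max_{x\in\Omega}\lambda(\mathcal{X};x)$.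 *)

(* Defs.v *)
From HB Require Import structures.
From mathcomp Require Import all_boot all_order all_algebra finmap.
From mathcomp Require Import all_classical all_reals all_analysis.

Set Implicit Arguments.
Unset Strict Implicit.
Unset Printing Implicit Defensive.

Import Order.TTheory GRing.Theory Num.Theory.
Import numFieldNormedType.Exports.

Local Open Scope fset_scope.
Local Open Scope classical_set_scope.
Local Open Scope ring_scope.

(* For n = 1 the only index is j = 0; the numerator vanishes and 0 / 0 = 0, so
   the value is {cos (gamma * pi / 2)}. *)
Definition bg_chebyshev (R : realType) (beta gamma : R) (n : nat) : {fset R} :=
  [fset cos ((2 - beta - gamma) * j%:R * pi / (2 * (n%:R - 1))
             + gamma * pi / 2) | j in iota 0 n].

Definition chebyshev_lobatto (R : realType) (n : nat) : {fset R} :=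
  [fset cos (j%:R * pi / n%:R) | j in iota 0 n.+1].

(* The Lagrange polynomials are indexed by the node z \in X itself: being a
   finite set, X enumerates its elements without repetition. *)
Definition lagrange (R : realType) (X : {fset R}) (z x : R) : R :=
  \prod_(y <- X | y != z) ((x - y) / (z - y)).

Definition lebesgue_fun (R : realType) (X : {fset R}) (x : R) : R :=
  \sum_(z <- X) `|lagrange X z x|.

(* On [-1, 1] this supremum is a maximum, see lebesgue_const_max. *)
Definition lebesgue_const (R : realType) (X : {fset R}) (Omega : set R) : R :=
  sup [set lebesgue_fun X x | x in Omega].

Lemma continuous_lebesgue_fun (R : realType) (X : {fset R}) :
  continuous (lebesgue_fun X).
Proof.
apply: continuous_big; first exact: add_continuous.
move=> z _ x; apply: cvg_norm; move: x.
apply: continuous_big; first exact: mul_continuous.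
move=> y _ x; apply: cvgM; last exact: cvg_cst.
by apply: cvgB; [exact: cvg_id|exact: cvg_cst].
Qed.

Lemma lebesgue_const_max (R : realType) (X : {fset R}) :
  (exists2 x : R, x \in `[-1, 1] &
    lebesgue_fun X x = lebesgue_const X `[-1, 1]) /\
  (forall x : R, x \in `[-1, 1] ->
    lebesgue_fun X x <= lebesgue_const X `[-1, 1]).
Proof.
have m11 : (-1 : R) <= 1 by exact: le_trans (lerN10 R) ler01.
have [c cI cM] := EVT_max m11
  (continuous_subspaceT (@continuous_lebesgue_fun R X)).
suff -> : lebesgue_const X `[-1, 1] = lebesgue_fun X c by split; first by exists c.
apply/eqP; rewrite eq_le; apply/andP; split.
  apply: ge_sup; first by exists (lebesgue_fun X c); exists c.
  by move=> _ [x xI <-]; exact: cM.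
apply: ub_le_sup; last by exists c.
by exists (lebesgue_fun X c) => _ [x xI <-]; exact: cM.
Qed.

(* Main.v *)
Require Import Defs.
From mathcomp Require Import all_boot all_order all_algebra finmap.
From mathcomp Require Import all_classical all_reals all_analysis.
From mathcomp Require Import ring lra.
Import Order.TTheory GRing.Theory Num.Theory.
Import numFieldNormedType.Exports.
Local Open Scope fset_scope.
Local Open Scope classical_set_scope.
Local Open Scope ring_scope.
Set Implicit Arguments.
Unset Strict Implicit.
Unset Printing Implicit Defensive.

(** Let V = U_(n-1) be the Chebyshev polynomial of the second kind, so that
    V(cos t) sin t = sin(n t). The n nodes cos(j pi / n), j < n, are exactly the
    roots of W = (1 - X) V, and evaluating W'(z) at a node z turns
    l_z(x) = W(x) / (W'(z) (x - z)) into closed forms ([lagrange_1] and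
    [norm_lagrange_inner]):
      n |l_1(x)| = |V(x)|,
      n |l_z(x)| |x - z| = (1 + z) (1 - x) |V(x)|     for z <> 1.
    At x = -1, where |V| = n, they give |l_1(-1)| = 1 and |l_z(-1)| = 2 for each
    of the n - 1 other nodes ([norm_lagrange_N1]), so the Lebesgue function
    takes the value 2n - 1 at -1.

    In fact no |l_z| exceeds its value at -1 anywhere on [-1, 1]
    ([norm_lagrange_le]), which gives the upper bound. There are two regimes.

    If x lies to the left of all the nodes, every factor |x - y| grows as x
    decreases to -1, so |l_z(x)| <= |l_z(-1)| ([norm_lagrange_left]).

    Otherwise x = cos t with 0 <= t <= pi - pi/n. For z = 1 the bound is
    |sin(n t)| <= n |sin t|. For z = cos s, put a = t/2, b = s/2, P = a + b and
    Q = a - b. Then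
      |l_z(x)| = |sin(n t)| / (2n) * |cot P + cot Q + 2 tan a|.
    Here |sin(n t)| = |sin(2n Q)| <= 2n |sin Q| bounds the cot Q term by 1,
    while P stays at distance at least pi/(2n) from 0 and pi, and a at distance
    at least pi/(2n) from pi/2; since y cos y <= sin y on [0, pi/2], this bounds
    |cot P| and tan a by 2n/pi. Altogether |l_z(x)| <= 1 + 3/pi <= 2 because
    pi >= 3 ([sin_mul_le_node_distance]). *)

(** * Chebyshev polynomials of both kinds *)

(** The pair (T_n, U_(n-1)), by the addition formulas for cos((n+1)t) and
    sin((n+1)t); it starts at (T_0, U_(-1)) = (1, 0). *)
Fixpoint chebTU (R : comNzRingType) (n : nat) : {poly R} * {poly R} :=
  if n is m.+1 then
    let: (t, u) := chebTU R m in ('X * t - (1 - 'X^2) * u, 'X * u + t)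
  else (1, 0).

(** The Chebyshev polynomial T_n of the first kind. *)
Definition chebT (R : comNzRingType) n := (chebTU R n).1.

(** The Chebyshev polynomial of the second kind with shifted index: [chebU R n]
    is U_(n-1), and [chebU R 0] is 0. *)
Definition chebU (R : comNzRingType) n := (chebTU R n).2.

Section Poly.
Variable R : comNzRingType.
Implicit Types (n : nat) (x : R).

Lemma chebTS n : chebT R n.+1 = 'X * chebT R n - (1 - 'X^2) * chebU R n.
Proof. by rewrite /chebT /chebU /=; case: chebTU. Qed.

Lemma chebUS n : chebU R n.+1 = 'X * chebU R n + chebT R n.
Proof. by rewrite /chebT /chebU /=; case: chebTU. Qed.

(** The second identity determines U_(n-1)' at the zeros of U_(n-1). *)
Lemma deriv_cheb n :
  (chebT R n)^`() = n%:R * chebU R n /\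
  (1 - 'X^2) * (chebU R n)^`() = 'X * chebU R n - n%:R * chebT R n.
Proof.
elim: n => [|n [IHT IHU]].
  by rewrite /chebT /chebU /= -[1]/(1%:P) derivC linear0 !mulr0 mul0r subr0.
have dX : (1 - 'X^2 : {poly R})^`() = - (2%:R * 'X).
  by rewrite derivB -[1]/(1%:P) derivC sub0r derivXn expr1 -mulr_natl.
rewrite chebTS chebUS derivB derivD !derivM derivX dX IHT IHU -natr1.
split; first by ring.
rewrite !mulrDr mul1r mulrCA IHU; ring.
Qed.

Lemma size_cheb n :
  (size (chebT R n) <= n.+1)%N /\ (size (chebU R n) <= n)%N.
Proof.
elim: n => [|n [IHT IHU]].
  by rewrite /chebT /chebU /= size_poly1 size_poly0.
have sX : forall p : {poly R}, (size ('X * p)%R <= (size p).+1)%N.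
  by move=> p; apply: leq_trans (size_polyMleq _ _) _; rewrite size_polyX.
rewrite chebTS chebUS; split; last first.
  apply: leq_trans (size_polyD _ _) _.
  by rewrite geq_max IHT (leq_trans (sX _)).
apply: leq_trans (size_polyD _ _) _; rewrite size_polyN.
rewrite geq_max (leq_trans (sX _)) //=.
rewrite mulrBl mul1r; apply: leq_trans (size_polyD _ _) _; rewrite size_polyN.
rewrite geq_max (leq_trans IHU (leqW (leqnSn n))) /=.
by rewrite expr2 -mulrA (leq_trans (sX _)) // ltnS (leq_trans (sX _)).
Qed.

Lemma chebU_1 n : (chebU R n).[1] = n%:R.
Proof.
suff [] : (chebT R n).[1] = 1 /\ (chebU R n).[1] = n%:R by [].
elim: n => [|n [IHT IHU]]; first by rewrite /chebT /chebU /= !hornerE.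
rewrite chebTS chebUS !hornerE /= IHT IHU -natr1 ?mul1r ?expr1n; split => //.
by rewrite subrr mul0r subr0.
Qed.

Lemma chebU_N1 n : (chebU R n).[-1] = (-1) ^+ n.+1 * n%:R.
Proof.
suff [] : (chebT R n).[-1] = (-1) ^+ n /\
  (chebU R n).[-1] = (-1) ^+ n.+1 * n%:R by [].
elim: n => [|n [IHT IHU]]; first by rewrite /chebT /chebU /= !hornerE ?mulr0.
rewrite chebTS chebUS !hornerE /= IHT IHU -natr1 !exprS; split; ring.
Qed.
End Poly.

(** * Trigonometric estimates *)

Section Trig.
Variable R : realType.
Implicit Types (n : nat) (x t : R).

Lemma cheb_cos n t :
  (chebT R n).[cos t] = cos (n%:R * t) /\
  (chebU R n).[cos t] * sin t = sin (n%:R * t).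
Proof.
elim: n => [|n [IHT IHU]].
  by rewrite /chebT /chebU /= !hornerE ?(mulr0n, mul0r) cos0 sin0.
have -> : n.+1%:R * t = n%:R * t + t by rewrite -natr1 mulrDl mul1r.
rewrite chebTS chebUS !hornerE /= cosD sinD -IHT -IHU.
have h := sin2cos2 t; split; ring: h.
Qed.

Lemma norm_sin_mulrn n t : `|sin (n%:R * t)| <= n%:R * `|sin t|.
Proof.
elim: n => [|n IHn]; first by rewrite !mul0r sin0 normr0.
rewrite -natr1 !mulrDl !mul1r sinD (le_trans (ler_normD _ _)) //.
rewrite !normrM lerD //.
  by apply: le_trans IHn; rewrite ler_piMr ?cos_max.
by rewrite ler_piMl ?cos_max.
Qed.

Lemma mul_cos_le_sin t : 0 <= t <= pi / 2 -> t * cos t <= sin t.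
Proof.
move=> /andP[t0 tpi].
pose f (y : R) := sin y - y * cos y.
have df (y : R) : is_derive y 1 f (y * sin y).
  rewrite /f; apply: is_derive_eq.
  rewrite /GRing.scale /=; ring.
have cf : {within `[0, t], continuous f}.
  apply: continuous_subspaceT => y.
  by apply: differentiable_continuous; apply/derivable1_diffP; case: (df y).
have [c cI] := MVT_segment t0 (fun y _ => df y) cf.
rewrite /f mul0r sin0 !subr0 => fE.
rewrite -subr_ge0 fE mulr_ge0 // mulr_ge0 //.
  by move: cI; rewrite in_itv => /andP[].
have pi0 := pi_gt0 R; apply: sin_ge0_pi.
move: cI; rewrite in_itv /= => /andP[]; lra.
Qed.

Lemma sin_le t : 0 <= t -> sin t <= t.
Proof.
move=> t0; have [->|tN0] := eqVneq t 0; first by rewrite sin0.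
have cf : {within `[0, t], continuous (@sin R)}.
  by apply: continuous_subspaceT; exact: continuous_sin.
have [c cI] := MVT_segment t0 (fun y _ => is_derive_sin y) cf.
by rewrite sin0 !subr0 => ->; rewrite ler_piMl // cos_le1.
Qed.

(** From sin(pi/6) <= pi/6, where sin(pi/6) = 1/2 by the formula for
    sin(3x). *)
Lemma pi_ge3 : 3 <= pi :> R.
Proof.
have pi0 := pi_gt0 R.
pose s : R := sin (pi / 6).
have s0 : 0 < s by apply: sin_gt0_pi; apply/andP; split; lra.
have: 1 = s * (3 - 4 * s ^+ 2).
  have := sin_pihalf R.
  have -> : pi / 2 = pi / 6 + pi / 6 + pi / 6 :> R by field.
  rewrite !sinD !cosD -/s => s3; rewrite -[LHS]s3.
  have h := cos2sin2 (pi / 6 : R); rewrite -/s in h; ring: h.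
move=> h.
have: (s + 1) * (2 * s - 1) ^+ 2 = 0 by lra.
move/eqP; rewrite mulf_eq0 sqrf_eq0 => /orP[]/eqP; first by lra.
have : s <= pi / 6 by apply: sin_le; lra.
lra.
Qed.
End Trig.

(** * Lagrange polynomials of a finite set *)

(* The unqualified name denotes a tuple of polynomials. *)
Local Notation lagrange := Defs.lagrange.

Section Lagrange.
Variable R : realType.
Implicit Types (X : {fset R}) (p : {poly R}) (x z : R).

Lemma lagrange_node X z : lagrange X z z = 1.
Proof.
by rewrite /lagrange big1 // => y yz; rewrite divff // subr_eq0 eq_sym.
Qed.

(** Any polynomial p of degree #X vanishing on X is a multiple of the node
    polynomial, whence l_z(x) = p(x) / (p'(z) (x - z)). *)
Lemma lagrange_deriv X p z x : size p = #|` X|.+1 ->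
  {in X, forall y, root p y} -> z \in X ->
  lagrange X z x * p^`().[z] * (x - z) = p.[x].
Proof.
move=> sp rp zX.
have -> : p = lead_coef p *: \prod_(y <- X) ('X - y%:P).
  apply: all_roots_prod_XsubC => //; first exact/allP.
  by rewrite uniq_rootsE fset_uniq.
set c := lead_coef p; rewrite (bigD1_seq z) //=.
set q := \prod_(y <- X | y != z) ('X - y%:P).
have qE y : q.[y] = \prod_(u <- X | u != z) (y - u).
  by rewrite horner_prod; apply: eq_bigr => u _; rewrite hornerXsubC.
have q0 : q.[z] != 0.
  rewrite qE prodf_seq_neq0; apply/allP => u _.
  by apply/implyP => uz; rewrite subr_eq0 eq_sym.
rewrite derivZ derivM derivXsubC mul1r !hornerE subrr mul0r addr0.
rewrite /lagrange prodf_div -!qE.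
by rewrite /=; field.
exact: fset_uniq.
Qed.

(** To the left of all the nodes, moving further left enlarges every factor. *)
Lemma norm_lagrange_left X z x x' : x' <= x -> {in X, forall y, x <= y} ->
  `|lagrange X z x| <= `|lagrange X z x'|.
Proof.
move=> xx' xX; rewrite /lagrange !normr_prod big_seq_cond [leRHS]big_seq_cond.
apply: ler_prod => y /andP[yX _]; rewrite normr_ge0 /= !normrM.
have := xX _ yX => xy.
by rewrite ler_wpM2r // !ler0_norm ?subr_le0 ?(le_trans xx') // lerN2 lerD2r.
Qed.
End Lagrange.

(** * The estimate at an inner node *)

Section Bound.
Variable R : realType.
Implicit Types (n : nat) (x t a b e : R).

(** A bound |cot y| <= 1 / e at distance at least e from 0 and pi. *)
Lemma norm_cos_le_sin e y : 0 <= e -> e <= y <= pi - e ->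
  e * `|cos y| <= sin y.
Proof.
move=> e0 /andP[ey ype]; have pi0 := pi_gt0 R.
wlog yle : y ey ype / y <= pi / 2.
  move=> H; have [/H->//|ylt] := leP y (pi / 2).
  have := H (pi - y); rewrite cosB sinB cospi sinpi.
  rewrite mul0r addr0 mulN1r mul0r sub0r mulN1r opprK normrN; apply; lra.
rewrite ger0_norm; last by apply: cos_ge0_pihalf; apply/andP; split; lra.
apply: le_trans (mul_cos_le_sin _); last by apply/andP; split; lra.
rewrite ler_wpM2r //; by apply: cos_ge0_pihalf; apply/andP; split; lra.
Qed.

Lemma sin_natpi n : sin (n%:R * pi) = 0 :> R.
Proof.
apply/eqP; rewrite -normr_le0.
by apply: le_trans (norm_sin_mulrn _ _) _; rewrite sinpi normr0 mulr0.
Qed.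

Lemma norm_cos_natpi n : `|cos (n%:R * pi)| = 1 :> R.
Proof. by apply/eqP; rewrite norm_cos_eq1 sin_natpi. Qed.

(** With x = cos(2a) and z = cos(2b) an inner node, this is the estimate
    |l_z(x)| <= 2 cleared of its denominators. *)
Lemma sin_mul_le_node_distance n j a b : (0 < n)%N ->
  let e := pi / (2 * n%:R) in
  0 <= a <= pi / 2 - e -> e <= b <= pi / 2 - e -> 2 * n%:R * b = j%:R * pi ->
  `|sin (2 * n%:R * a)| * (sin a * cos b ^+ 2)
    <= 2 * n%:R * (cos a * `|sin (a + b) * sin (a - b)|).
Proof.
move=> n0 e /andP[a0 ae] /andP[eb be] bE.
have pi0 := pi_gt0 R; have pi3 := pi_ge3 R.
have N0 : 0 < n%:R :> R by rewrite ltr0n.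
set N := n%:R in N0 bE e ae eb be *.
have e0 : 0 < e by rewrite divr_gt0 // mulr_gt0.
have eN : 2 * N * e = pi by rewrite /e; field; rewrite gt_eqF.
(* The factor 2 * N * e = pi is at least 3. *)
have e3 y c : 0 <= c -> e * c <= y -> 3 * c <= 2 * N * y.
  move=> c0 h; apply: (@le_trans _ _ (pi * c)); first by rewrite ler_wpM2r.
  by rewrite -eN -mulrA ler_wpM2l // mulr_ge0 // ltW.
set S := `|sin (2 * N * a)|.
have S1 : S <= 1 by exact: sin_max.
have SQ : S <= 2 * N * `|sin (a - b)|.
  rewrite /S; have -> : 2 * N * a = (2 * n)%:R * (a - b) + j%:R * pi.
    by rewrite -bE natrM; ring.
  rewrite (sinD (_ * _)) sin_natpi mulr0 addr0 normrM norm_cos_natpi mulr1.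
  rewrite -natrM.
  exact: norm_sin_mulrn.
have HP : 3 * `|cos (a + b)| <= 2 * N * sin (a + b).
  by apply: e3 => //; apply: norm_cos_le_sin; [exact: ltW|lra].
have sa0 : 0 <= sin a by apply: sin_ge0_pi; lra.
have ca0 : 0 <= cos a by apply: cos_ge0_pihalf; lra.
have sP0 : 0 <= sin (a + b) by apply: sin_ge0_pi; lra.
have HA : 3 * sin a <= 2 * N * cos a.
  apply: e3 => //; have := @norm_cos_le_sin e (pi / 2 - a).
  rewrite cosB sinB cos_pihalf sin_pihalf !mul0r !mul1r add0r subr0.
  rewrite ger0_norm //; apply; [exact: ltW|lra].
(* From cos(b)^2 = cos(a)^2 + sin(a + b) sin(a - b) and
   2 sin(a) cos(a) = sin((a + b) + (a - b)); the three terms below contribute n,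
   n/3 and 2n/3 out of 2n. *)
have -> : sin a * cos b ^+ 2 =
   cos a / 2 * (sin (a + b) * cos (a - b))
    + cos a / 2 * (cos (a + b) * sin (a - b))
    + sin a * (sin (a + b) * sin (a - b)).
  rewrite !sinD !cosD sinN cosN.
  have ha := sin2cos2 a; have hb := sin2cos2 b.
  by field: ha hb.
rewrite normrM (ger0_norm sP0).
set P := sin (a + b) in HP sP0 *; set q := sin (a - b) in SQ *.
set CP := cos (a + b) in HP *.
set C := cos a in HA ca0 *; set s := sin a in HA sa0 *.
have S0 : 0 <= S by exact: normr_ge0.
have T1 : S * (P * cos (a - b)) <= 2 * N * (P * `|q|).
  rewrite mulrCA [leRHS]mulrCA ler_wpM2l //.
  by apply: le_trans SQ; rewrite ler_piMr ?cos_le1.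
have T2 : 3 * (S * (CP * q)) <= 2 * N * (P * `|q|).
  apply: (@le_trans _ _ (3 * (`|CP| * `|q|))).
    rewrite ler_pM2l // -normrM; apply: le_trans (ler_norm _) _.
    by rewrite [leLHS]normrM (ger0_norm S0) ler_piMl.
  by rewrite !mulrA ler_wpM2r.
have T3 : 3 * (S * (s * (P * q))) <= 2 * N * (C * (P * `|q|)).
  apply: (@le_trans _ _ (3 * (s * (P * `|q|)))).
    rewrite ler_pM2l //.
    have h : s * (P * q) <= s * (P * `|q|).
      by rewrite ler_wpM2l // ler_wpM2l // ler_norm.
    apply: le_trans (ler_wpM2l S0 h) _; rewrite ler_piMl //.
    by rewrite !mulr_ge0.
  by rewrite !mulrA -!(mulrA _ P) ler_wpM2r // mulr_ge0.
have := ler_wpM2l ca0 T1; have := ler_wpM2l ca0 T2.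
rewrite !mulrDr; lra.
Qed.
End Bound.

(** * The nodes cos(j pi / n), j < n *)

Section Nodes.
Variables (R : realType) (n : nat).
Hypothesis n0 : (0 < n)%N.
Implicit Types (x t z : R) (j : nat).

Let N0 : 0 < n%:R :> R. Proof. by rewrite ltr0n. Qed.

Definition node_angle j : R := j%:R * pi / n%:R.

(** The Chebyshev-Lobatto points without -1. *)
Definition nodes : {fset R} := [fset cos (node_angle j) | j in iota 0 n].

(** Proportional to the monic polynomial with root set [nodes]. *)
Definition node_poly : {poly R} := (1 - 'X) * chebU R n.

Lemma nodesP z :
  reflect (exists2 j, (j < n)%N & z = cos (node_angle j)) (z \in nodes).
Proof.
apply: (iffP (imfsetP _ _ _ _)) => /= -[j jn ->]; exists j => //.
  by move: jn; rewrite mem_iota.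
by rewrite mem_iota.
Qed.

Lemma node_angle_ge0 j : 0 <= node_angle j.
Proof. by rewrite /node_angle divr_ge0 // mulr_ge0 // pi_ge0. Qed.

Lemma node_angle_lepi j : (j <= n)%N -> node_angle j <= pi.
Proof.
move=> jn; rewrite /node_angle ler_pdivrMr // mulrC ler_pM2l ?pi_gt0 //.
by rewrite ler_nat.
Qed.

Lemma node_angle_itv j : (j <= n)%N -> node_angle j \in `[0, pi].
Proof. by move=> jn; rewrite in_itv /= node_angle_ge0 node_angle_lepi. Qed.

Lemma node_angle_le j : (j < n)%N -> node_angle j <= pi - pi / n%:R.
Proof.
move=> jn; have -> : pi - pi / n%:R = (n%:R - 1) * pi / n%:R :> R.
  by field; rewrite gt_eqF.
rewrite /node_angle ler_wpM2r ?invr_ge0 // ler_wpM2r ?pi_ge0 //.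
by rewrite lerBrDr natr1 ler_nat.
Qed.

Lemma node_angle_ge j : (0 < j)%N -> pi / n%:R <= node_angle j.
Proof.
move=> j0; rewrite /node_angle -mulrA ler_peMl ?ler1n //.
by rewrite divr_ge0 // pi_ge0.
Qed.

Lemma node_angleM j : n%:R * node_angle j = j%:R * pi.
Proof. by rewrite /node_angle; field; rewrite gt_eqF. Qed.

Lemma cos_node_angle_inj j k : (j <= n)%N -> (k <= n)%N ->
  cos (node_angle j) = cos (node_angle k) -> j = k.
Proof.
move=> jn kn /cos_inj h; have {}h := h (node_angle_itv jn) (node_angle_itv kn).
have : n%:R * node_angle j = n%:R * node_angle k by rewrite h.
rewrite !node_angleM => /(mulIf (lt0r_neq0 (pi_gt0 R)))/eqP.
by rewrite eqr_nat => /eqP.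
Qed.

Lemma cos_node_angle0 : cos (node_angle 0) = 1.
Proof. by rewrite /node_angle !mul0r cos0. Qed.

Lemma cos_node_anglen : cos (node_angle n) = -1.
Proof. by rewrite /node_angle mulrAC divff ?gt_eqF // mul1r cospi. Qed.

Lemma node1 : 1 \in nodes.
Proof. by apply/nodesP; exists 0; rewrite ?cos_node_angle0. Qed.

Lemma card_nodes : #|` nodes| = n.
Proof.
rewrite card_in_imfset /=; last first.
  move=> j k; rewrite !mem_iota /= => jn kn.
  by apply: cos_node_angle_inj; exact: ltnW.
by rewrite undup_id ?iota_uniq ?size_iota.
Qed.

Lemma inner_nodeP z : z \in nodes -> z != 1 ->
  exists2 j, (0 < j < n)%N & z = cos (node_angle j).
Proof.
case/nodesP => -[|j] jn ->; first by rewrite cos_node_angle0 eqxx.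
by exists j.+1.
Qed.

Lemma sin_node_angle_gt0 j : (0 < j < n)%N -> 0 < sin (node_angle j).
Proof.
move=> /andP[j0 jn]; apply: sin_gt0_pi.
have := node_angle_le jn; have := node_angle_ge j0.
have : 0 < pi / n%:R :> R by rewrite divr_gt0 // pi_gt0.
move=> ? ? ?; apply/andP; split; lra.
Qed.

Lemma node_itv z : z \in nodes -> -1 < z <= 1.
Proof.
case/nodesP => j jn ->; rewrite cos_le1 andbT lt_neqAle cos_geN1 andbT.
apply/eqP; rewrite -cos_node_anglen => /cos_node_angle_inj h.
by have := jn; rewrite h ?ltnn // ltnW.
Qed.

Lemma chebU_inner z : z \in nodes -> z != 1 -> (chebU R n).[z] = 0.
Proof.
move=> zX z1; have [j jn ->] := inner_nodeP zX z1.
have [_] := cheb_cos n (node_angle j); rewrite node_angleM sin_natpi => /eqP.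
by rewrite mulf_eq0 (gt_eqF (sin_node_angle_gt0 jn)) orbF => /eqP.
Qed.

Lemma root_node_poly : {in nodes, forall z, root node_poly z}.
Proof.
move=> z zX; rewrite rootE /node_poly !hornerE /=.
have [->|z1] := eqVneq z 1; first by rewrite subrr mul0r.
by rewrite chebU_inner // mulr0.
Qed.

(** The degree is at most n by construction, and at least n because there are n
    distinct roots and the value at -1 is nonzero. *)
Lemma size_node_poly : size node_poly = #|` nodes|.+1.
Proof.
apply/eqP; rewrite eqn_leq; apply/andP; split.
  apply: leq_trans (size_polyMleq _ _) _.
  have -> : (1 - 'X : {poly R}) = - ('X - 1%:P) by rewrite opprB.
  rewrite size_polyN size_XsubC card_nodes add2n /= ltnS.
  by have [] := size_cheb R n.
rewrite max_poly_roots //; last by exact: fset_uniq.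
  apply/eqP => h; have := chebU_N1 R n.
  have : (1 - (-1)) * (chebU R n).[-1] = 0.
    by have := congr1 (horner^~ (-1)) h; rewrite /node_poly !hornerE.
  move=> /eqP; rewrite mulf_eq0 => /orP[|/eqP-> /esym/eqP].
    by rewrite opprK -(natrD _ 1 1) pnatr_eq0.
  by rewrite mulf_eq0 signr_eq0 gt_eqF.
by apply/allP; exact: root_node_poly.
Qed.

Lemma deriv_node_poly x :
  node_poly^`().[x] = (1 - x) * (chebU R n)^`().[x] - (chebU R n).[x].
Proof.
rewrite /node_poly derivM derivB derivX -[1 in X in X^`()]/(1%:P) derivC.
by rewrite sub0r mulN1r !hornerE addrC.
Qed.

Lemma lagrange_1 x : x != 1 -> n%:R * lagrange nodes 1 x = (chebU R n).[x].
Proof.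
move=> x1; have := lagrange_deriv x size_node_poly root_node_poly node1.
rewrite deriv_node_poly /node_poly !hornerE /= subrr mul0r sub0r chebU_1 => h.
by apply: (@mulfI _ (1 - x)); [rewrite subr_eq0 eq_sym | rewrite -h; ring].
Qed.

(** At an inner node V vanishes, and (1 - z^2) V'(z) = - n T_n(z) has absolute
    value n. *)
Lemma norm_lagrange_inner z x : z \in nodes -> z != 1 ->
  n%:R * (`|lagrange nodes z x| * `|x - z|) =
  (1 + z) * `|(1 - x) * (chebU R n).[x]|.
Proof.
move=> zX z1; have := lagrange_deriv x size_node_poly root_node_poly zX.
have /andP[zN1 zle1] := node_itv zX.
have Uz := chebU_inner zX z1.
have [_ /(congr1 (horner^~ z))] := deriv_cheb R n.
have [j jn zE] := inner_nodeP zX z1.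
have := (cheb_cos n (node_angle j)).1; rewrite -zE node_angleM => Tz.
rewrite deriv_node_poly /node_poly -[n%:R : {poly R}]polyC_natr.
rewrite !hornerE /= Uz Tz => dU <-.
have -> : 1 + z = `|1 + z| by rewrite ger0_norm; lra.
have E : (1 + z) * (lagrange nodes z x * ((1 - z) * (chebU R n)^`().[z] - 0)
    * (x - z)) = - (n%:R * cos (j%:R * pi)) * (lagrange nodes z x * (x - z)).
  by rewrite mulr0 sub0r in dU; rewrite -dU; ring.
rewrite -[RHS]normrM E !normrM normrN normrM norm_cos_natpi mulr1 normr_nat.
by rewrite mulrA.
Qed.

(** The value of |l_z| at -1, which is its maximum over [-1, 1]. *)
Definition lagrange_max z : R := if z == 1 then 1 else 2.

Lemma norm_lagrange_N1 z : z \in nodes ->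
  `|lagrange nodes z (-1)| = lagrange_max z.
Proof.
move=> zX; have nn : n%:R != 0 :> R by rewrite gt_eqF.
have UN1 : `|(chebU R n).[-1]| = n%:R.
  by rewrite chebU_N1 normrM normr_sign mul1r ger0_norm.
apply: (mulfI nn); rewrite /lagrange_max; case: eqVneq => [->|z1].
  rewrite -[X in X * `|_|]normr_nat -normrM lagrange_1 ?UN1 ?mulr1 //.
  by rewrite lt_eqF //; lra.
have /andP[zN1 zle1] := node_itv zX.
have := norm_lagrange_inner (-1) zX z1.
rewrite normrM UN1 (@ler0_norm _ (-1 - z)); last by lra.
rewrite (@ger0_norm _ (1 - -1)); last by lra.
move=> h; apply: (@mulIf _ (1 + z)); first by rewrite gt_eqF //; lra.
lra.
Qed.

(** The regime x >= cos((n-1) pi / n), the smallest node. *)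
Lemma norm_lagrange_right z x : z \in nodes -> -1 <= x <= 1 ->
  acos x <= pi - pi / n%:R -> `|lagrange nodes z x| <= lagrange_max z.
Proof.
move=> zX x11 tn; pose t := acos x.
have pi0 := pi_gt0 R.
have t0 : 0 <= t by exact: acos_ge0.
have e0 : 0 < pi / n%:R :> R by rewrite divr_gt0.
have xE : cos t = x by rewrite acosK // in_itv.
rewrite -/t in tn; clearbody t.
have [->|x1] := eqVneq x 1.
  rewrite /lagrange_max; case: eqVneq => [->|z1].
    by rewrite lagrange_node normr1.
  have := norm_lagrange_inner 1 zX z1; rewrite subrr mul0r normr0 mulr0 => /eqP.
  rewrite mulf_eq0 gt_eqF //= mulf_eq0 [X in _ || X]normr_eq0 subr_eq0.
  rewrite (eq_sym 1) (negbTE z1) orbF; by move=> /eqP ->.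
have st0 : 0 < sin t.
  apply: sin_gt0_pi; rewrite lt_neqAle t0 andbT; apply/andP; split; last by lra.
  by apply: contra_neq x1 => t0'; rewrite -xE -t0' cos0.
have [_ Ut] := cheb_cos n t; rewrite xE in Ut.
have nt := norm_sin_mulrn n t.
rewrite /lagrange_max; case: eqVneq => [->|z1].
  rewrite -(ler_pM2l N0) mulr1 -[X in X * `|_|]normr_nat -normrM lagrange_1 //.
  rewrite -(ler_pM2r st0) -[in leLHS](gtr0_norm st0) -normrM Ut.
  by rewrite -[sin t in leRHS]gtr0_norm.
have [-> | xz] := eqVneq x z; first by rewrite lagrange_node normr1 ler1n.
have nxz : 0 < `|x - z| by rewrite normr_gt0 subr_eq0.
rewrite -(ler_pM2r nxz) -(ler_pM2l N0) norm_lagrange_inner //.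
have [j jn zE] := inner_nodeP zX z1.
have /andP[j0 jltn] := jn.
have eE : pi / (2 * n%:R) = pi / n%:R / 2 :> R by field; rewrite gt_eqF.
have := @sin_mul_le_node_distance R n j (t / 2) (node_angle j / 2) n0.
rewrite /= eE.
have := node_angle_le jltn; have := node_angle_ge j0 => th1 th2.
have -> : 2 * n%:R * (node_angle j / 2) = j%:R * pi.
  by rewrite -node_angleM; field.
have -> : 2 * n%:R * (t / 2) = n%:R * t by field.
move=> /(_ _ _ erefl) H.
have {}H := H (ltac:(lra)) (ltac:(lra)).
set a := t / 2 in H; set b := node_angle j / 2 in H.
have tE : t = a + a by rewrite /a; lra.
have bE : node_angle j = b + b by rewrite /b; lra.
have ca0 : 0 < cos a.
  by apply: cos_gt0_pihalf; rewrite /a; apply/andP; split; lra.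
have ha := sin2cos2 a; have hb := sin2cos2 b.
have xa : x = 1 - 2 * sin a ^+ 2 by rewrite -xE tE cosD; ring: ha.
have xzE : x - z = - (2 * (sin (a + b) * sin (a - b))).
  rewrite xa zE bE cosD sinD sinB; ring: ha hb.
have zb : 1 + z = 2 * cos b ^+ 2 by rewrite zE bE cosD; ring: hb.
have sta : sin t = 2 * sin a * cos a by rewrite tE sinD; ring.
rewrite -(ler_pM2l ca0) xzE normrN (normrM 2) normr_nat zb.
have -> : cos a * (2 * cos b ^+ 2 * `|(1 - x) * (chebU R n).[x]|) =
   2 * (`|sin (n%:R * t)| * (sin a * cos b ^+ 2)).
  have sa0 : 0 <= sin a by apply: sin_ge0_pi; rewrite /a; lra.
  rewrite -Ut normrM normrM (gtr0_norm st0) ger0_norm; last by lra.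
  rewrite sta xa; ring.
lra.
Qed.

Lemma norm_lagrange_le z x : z \in nodes -> -1 <= x <= 1 ->
  `|lagrange nodes z x| <= lagrange_max z.
Proof.
move=> zX x11; have /andP[x1 x2] := x11.
have [xX|] := boolP [forall y : nodes, x <= val y].
  rewrite -norm_lagrange_N1 //; apply: norm_lagrange_left => // y yX.
  by have /forallP /(_ [` yX]) := xX.
rewrite negb_forall => /existsP[[y yX]] /=; rewrite -ltNge => yx.
apply: norm_lagrange_right => //.
move: yx; case/nodesP: yX => j jn -> yx.
apply: le_trans (node_angle_le jn); rewrite leNgt.
apply/negP => h; move: yx; rewrite -[x]acosK ?in_itv //=.
rewrite ltr_cos ?node_angle_itv 1?ltnW //.
  by rewrite ltNge (ltW h).
by rewrite in_itv /= acos_ge0 // acos_lepi.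
Qed.

Lemma sum_lagrange_max : \sum_(z <- nodes) lagrange_max z = 2 * n%:R - 1.
Proof.
have h : \sum_(z <- nodes) 2 = 2 * n%:R :> R.
  by rewrite big_const_seq count_predT card_nodes iter_addr_0 mulr_natr.
rewrite -h (bigD1_seq 1) ?node1 ?fset_uniq //=.
rewrite [in RHS](bigD1_seq 1) ?node1 ?fset_uniq //=.
rewrite (eq_bigr (fun=> 2)); first by rewrite {1}/lagrange_max eqxx; lra.
by move=> z /negbTE z1; rewrite /lagrange_max z1.
Qed.

(** * The Lebesgue constant *)

Lemma lebesgue_const_nodes : lebesgue_const nodes `[-1, 1] = 2 * n%:R - 1.
Proof.
have [[c cI <-] M] := lebesgue_const_max nodes.
apply/eqP; rewrite eq_le -sum_lagrange_max; apply/andP; split.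
  rewrite /lebesgue_fun big_seq [leRHS]big_seq; apply: ler_sum => z zX.
  by apply: norm_lagrange_le => //; move: cI; rewrite in_itv.
apply: le_trans (M (-1) _); last first.
  by rewrite in_itv /= lexx -subr_ge0 opprK addr_ge0.
rewrite /lebesgue_fun big_seq [leRHS]big_seq; apply: ler_sum => z zX.
by rewrite norm_lagrange_N1.
Qed.

Lemma bg_chebyshev_nodes : bg_chebyshev (2 / n%:R) 0 n = nodes.
Proof.
apply: eq_in_imfset => //= j; rewrite mem_iota /= => jn.
congr cos; rewrite /node_angle subr0 mul0r mul0r addr0.
(* For n = 1 the only index is j = 0 and both angles vanish. *)
case: (ltngtP n 1) n0 jn => [||->] // => [n1 _ _|_].
  have nn : n%:R != 0 :> R by rewrite gt_eqF.
  by field; rewrite nn subr_eq0 (eqr_nat _ n 1) gtn_eqF.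
by rewrite ltnS leqn0 => /eqP ->; rewrite !(mulr0, mul0r).
Qed.

Lemma nodes_lobatto : nodes = (chebyshev_lobatto R n `\ (-1))%fset.
Proof.
apply/fsetP => z; rewrite in_fsetD1; apply/idP/andP.
  move=> zX; have /andP[zN1 _] := node_itv zX; rewrite gt_eqF //; split=> //.
  have /nodesP[j jn ->] := zX.
  by apply/imfsetP; exists j => //; rewrite mem_iota /= ltnS ltnW.
move=> [zN1 /imfsetP[j jn zE]]; move: jn.
rewrite mem_iota add0n ltnS => /andP[_].
rewrite leq_eqVlt => /orP[/eqP jn|jn]; last first.
  by apply/nodesP; exists j.
by rewrite zE jn -/(node_angle n) cos_node_anglen eqxx in zN1.
Qed.
End Nodes.

Theorem theorem3 (R : realType) (n : nat) (hn : (1 <= n)%N) :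
  [/\ bg_chebyshev (2 / n%:R) 0 n
        = [fset cos (j%:R * pi / n%:R) | j in iota 0 n] :> {fset R},
      bg_chebyshev (2 / n%:R) 0 n
        = (chebyshev_lobatto R n `\ (-1))%fset &
      lebesgue_const (bg_chebyshev (2 / n%:R) 0 n) (`[-1, 1] : set R)
        = 2 * n%:R - 1 ].
Proof.
rewrite (bg_chebyshev_nodes R hn); split => //; first exact: nodes_lobatto.
exact: lebesgue_const_nodes.
Qed.
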